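(* Let $n\ge 2$ and let $D$ be a loopless multigraph on the vertex set of $K_{n,n}$. If $D$ has at most $2n-3$ edges (counted with multiplicity) and $\Delta(D)\le n$, then $D$ is realizable in $K_{n,n}$.
   Context: $K_{n,n}$ is the complete bipartite graph with color classes $A=\{a_1,\dots,a_n\}$ and $B=\{b_1,\dots,b_n\}$. Given a simple graph $G$ and a loopless multigraph $D$ on the same vertex set, $D$ is realizable in $G$ if one can choose, for every edge $e\in E(D)$ (counted with multiplicity), a path $P(e)$ in $G$ joining the end-vertices of $e$, such that these paths are pairwise edge-disjoint. $\Delta(D)$ is the maximum degree of $D$ counting multiplicities. *)

(* Defs.v *)
From mathcomp Require Import all_boot.

Set Implicit Arguments.
Unset Strict Implicit.
Unset Printing Implicit Defensive.

Record sgraph (V : finType) := SGraph {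
  adj :> rel V;
  adj_sym : symmetric adj;
  adj_irr : irreflexive adj }.

(* Parallel edges are distinct elements of [edge] with the same ends, so that *)
(* [#|edge D|] counts edges with multiplicity; [edge_ends] excludes loops.    *)
Record multigraph (V : finType) := MultiGraph {
  edge : finType;
  ends : edge -> {set V};
  edge_ends : forall e : edge, #|ends e| = 2 }.

Section Realizability.

Variable V : finType.

Definition degree (D : multigraph V) (v : V) : nat :=
  #|[set e : edge D | v \in ends e]|.

Definition max_degree (D : multigraph V) : nat := \max_(v : V) degree D v.

(* A walk is given by its first vertex and the sequence of the later ones. *)
Definition is_path (G : sgraph V) (w : V * seq V) : bool :=
  path G w.1 w.2 && uniq (w.1 :: w.2).

Definition walk_ends (w : V * seq V) : {set V} := [set w.1; last w.1 w.2].

Definition walk_edges (w : V * seq V) : seq {set V} :=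
  pairmap (fun u v => [set u; v]) w.1 w.2.

Definition realizable (G : sgraph V) (D : multigraph V) : Prop :=
  exists P : edge D -> V * seq V,
    (forall e, is_path G (P e) /\ walk_ends (P e) = ends e) /\
    (forall e f, e != f -> [disjoint walk_edges (P e) & walk_edges (P f)]).

End Realizability.

Section CompleteBipartite.

Variable n : nat.

(* [inl i] is a_(i+1) and [inr j] is b_(j+1). *)
Definition Knn_adj : rel ('I_n + 'I_n)%type := fun u v =>
  match u, v with
  | inl _, inr _ | inr _, inl _ => true
  | _, _ => false
  end.

Lemma Knn_adj_sym : symmetric Knn_adj.
Proof. by case=> [i|i] [j|j]. Qed.

Lemma Knn_adj_irr : irreflexive Knn_adj.
Proof. by case. Qed.

Definition Knn : sgraph ('I_n + 'I_n)%type := SGraph Knn_adj_sym Knn_adj_irr.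

End CompleteBipartite.

(* Main.v *)
Require Import Defs.
From mathcomp Require Import all_boot zify.

Set Implicit Arguments.
Unset Strict Implicit.
Unset Printing Implicit Defensive.

(* The theorem is proved for complete bipartite graphs whose sides A and B    *)
(* differ in size by at most one, when each vertex has at most as many        *)
(* demands as neighbours and there are at most |A| + |B| - 3 demands, by      *)
(* removing vertices one at a time.  To remove a in A, its star is used up:   *)
(* a demand {a, b} with b in B is served by the edge ab, the other demands at *)
(* a are handed over to distinct vertices of B, and each vertex of B of full  *)
(* degree passes one of its demands through a to another vertex of B.  A      *)
(* count of the demands shows that the star has room for this, whatever a is. *)
(* The number of demands must also drop by one, which is automatic if some    *)
(* demand joins A to B; if there is none but some demand lies inside B, then  *)
(* a vertex a of minimal degree has room to serve one of these.  There        *)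
(* remains the case |A| = |B| + 1 with all demands inside A.  If two of them  *)
(* are parallel, their common ends are removed together; otherwise some b in  *)
(* B serves two disjoint demands that cover all vertices of full degree.      *)

(** A demand is a pair of vertices, and the empty set stands for a demand already served. The only
    routing step is [route_move]: a demand {u, v} takes the edge uw, this edge is deleted, and {w,
    v} remains, or nothing if w = v. Removing a means spending edges of its star on such steps until
    no demand contains a. Two edges ab1 and ab2 together pass a demand from b1 to b2 ([hub_lift]),
    or serve it if it is {b1, b2}.

    When a goes, each b in B loses one unit of capacity. With A the side without a, the vertices of
    degree |A| must receive nothing, and the tight ones, of degree |A| + 1, must lose a demand. Let
    H be the set of vertices of degree at least |A| among the free neighbours of a, and T the set of
    tight ones. By [hub_balanced] it suffices that a has deg a + |H| free edges, and one more if |T|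
    is odd. [hub_count] gets this from a double count of the demands that meet H: none of them
    contains a once the demands along free edges of a are served.

    The bound |A| + |B| - 3 drops by one with each vertex, so a demand must be served too unless
    there is slack: see [remove_any], [remove_direct] and [remove_inside]. In the remaining case,
    [stuck_simple] and [stuck_parallel] remove two vertices and serve two demands at once;
    [disjoint_demands] is the combinatorial core of the former. *)

(* Hypotheses about sets slow [lia] down by orders of magnitude. *)
Ltac slia :=
  repeat match goal with
  | H : ?T |- _ => lazymatch T with
      | is_true (leq _ _) => fail
      | @eq nat _ _ => fail
      | _ => clear H
      end
  end; lia.

(** * Routing one demand over one edge *)

Section Routing.

Variables V E : finType.
Implicit Types (G : rel V) (f : E -> {set V}) (e : E) (u v w x y : V).
Implicit Types (A B R S : {set V}).

(** Walks replace paths, so that an edge can be attached to a walk without any care for repeated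
    vertices; [realizable_of_routable] shortens them at the end. *)
Definition routable G f : Prop :=
  exists P : E -> V * seq V,
    (forall e, f e != set0 -> path G (P e).1 (P e).2 /\ walk_ends (P e) = f e) /\
    (forall e e', f e != set0 -> f e' != set0 -> e != e' ->
       [disjoint walk_edges (P e) & walk_edges (P e')]).

Definition deg f v := #|[set e | v \in f e]|.
Definition load f := #|[set e | f e != set0]|.
Definition pairs_in S f := forall e, f e != set0 -> #|f e| = 2 /\ f e \subset S.
Definition upd f e S : E -> {set V} := fun d => if d == e then S else f d.
(** What is left of a demand [S] at [u] once it has used the edge uw. *)
Definition shift u w S := if w \in S then set0 else w |: (S :\ u).
Definition del G u w : rel V := fun x y => G x y && ([set x; y] != [set u; w]).

Lemma routable_mono G G' f : subrel G G' -> routable G f -> routable G' f.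
Proof.
move=> sGG [P [Pp Pd]]; exists P; split=> // e fe.
by have [Ge We] := Pp e fe; split=> //; apply: sub_path Ge.
Qed.

Lemma routable_ext G f f' : f =1 f' -> routable G f -> routable G f'.
Proof.
move=> ff' [P [Pp Pd]]; exists P; split=> [e|e e']; rewrite -!ff'; first exact: Pp.
exact: Pd.
Qed.

Lemma walk_edgesP G x s X : path G x s -> X \in walk_edges (x, s) ->
  exists y z, G y z /\ X = [set y; z].
Proof.
rewrite /walk_edges /=; elim: s x => //= y s IHs x /andP[Gxy Gs].
by rewrite inE => /orP[/eqP->|/IHs]; [exists x, y | apply].
Qed.

Lemma walk_edges_rcons x s y :
  walk_edges (x, rcons s y) = rcons (walk_edges (x, s)) [set last x s; y].
Proof. by rewrite /walk_edges /=; elim: s x => //= z s IHs x; rewrite IHs. Qed.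

Lemma pair_eq x y u v : [set x; y] = [set u; v] -> u != v ->
  (x = u /\ y = v) \/ (x = v /\ y = u).
Proof.
move=> Exy uv.
have /set2P[ux|uy] : u \in [set x; y] by rewrite Exy set21.
  have /set2P[vx|vy] : v \in [set x; y] by rewrite Exy set22.
    by rewrite ux vx eqxx in uv.
  by left.
have /set2P[vx|vy] : v \in [set x; y] by rewrite Exy set22.
  by right.
by rewrite uy vy eqxx in uv.
Qed.

(** The walk found for the shifted demand is extended by the edge uw, which no other walk uses
    because it was deleted. *)
Lemma route_move G f e u w :
  symmetric G -> G u w -> #|f e| = 2 -> u \in f e -> u != w ->
  routable (del G u w) (upd f e (shift u w (f e))) -> routable G f.
Proof.
move=> symG Guw /eqP/cards2P[p [q [pq fepq]]] ufe uw [P [Pp Pd]].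
have {p q pq ufe fepq} [v uv fe] : exists2 v, u != v & f e = [set u; v].
  move: ufe; rewrite fepq !inE => /orP[]/eqP->; first by exists q.
  by exists p; rewrite 1?eq_sym // setUC.
have Gdel : subrel (del G u w) G by move=> x y /andP[].
have wfe : (w \in f e) = (w == v) by rewrite fe !inE [w == u]eq_sym (negbTE uw).
have avoid e' : e' != e -> f e' != set0 -> [set u; w] \notin walk_edges (P e').
  move=> e'e fe'; have := Pp e'; rewrite /upd (negbTE e'e) => /(_ fe')[pe' _].
  case: (P e') pe' => x s /= pe'; apply/negP => /(walk_edgesP pe')[y [z [/andP[_]]]].
  by move=> /eqP yz /esym.
suff [W [GW eW sW]] : exists W : V * seq V, [/\ path G W.1 W.2, walk_ends W = f e &
    forall X e', X \in walk_edges W -> e' != e -> f e' != set0 ->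
      X \notin walk_edges (P e')].
  exists (fun d : E => if d == e then W else P d); split=> [x fx|x y fx fy xy].
    case: eqP => [->|/eqP xe]; first by split.
    have := Pp x; rewrite /upd (negbTE xe) => /(_ fx)[Px Ex].
    by split=> //; apply: sub_path Px.
  case: eqP => [xe|/eqP xe]; case: eqP => [ye|/eqP ye].
  - by rewrite xe ye eqxx in xy.
  - by apply/pred0P => X /=; apply/negP => /andP[/sW/(_ ye fy)/negP].
  - by apply/pred0P => X /=; apply/negP => /andP[Xx /sW/(_ xe fx)/negP].
  have := Pd x y; rewrite /upd (negbTE xe) (negbTE ye); exact.
case: (eqVneq w v) wfe => [wv|wv] wfe.
  exists (u, [:: w]); split; rewrite /walk_ends /= ?Guw ?fe ?wv // => X e'.
  by rewrite /walk_edges /= inE => /eqP->; rewrite -wv; apply: avoid.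
have sfe : shift u w (f e) = [set w; v].
  rewrite /shift wfe fe; apply/setP => x; rewrite !inE.
  by case: (eqVneq x u) => [->|]; rewrite ?(negbTE uv) ?(negbTE uw).
have := Pp e; rewrite /upd eqxx sfe.
have -> : [set w; v] != set0 by apply/set0Pn; exists w; rewrite set21.
case/(_ isT) => Ge We.
have sP X e' : X \in walk_edges (P e) -> e' != e -> f e' != set0 -> X \notin walk_edges (P e').
  move=> Xe e'e fe'; have := Pd e e'; rewrite /upd eqxx (negbTE e'e) sfe [e == e']eq_sym e'e fe'.
  have -> : [set w; v] != set0 by apply/set0Pn; exists w; rewrite set21.
  by move=> /(_ isT isT isT)/pred0P/(_ X) /=; rewrite Xe /= => /negbT.
case: (P e) Ge We sP => x s /= Ge; rewrite /walk_ends /= => /pair_eq/(_ wv) Wxy sP.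
have {Ge} Gs := sub_path Gdel Ge.
case: Wxy => -[xw lw].
  exists (u, x :: s); rewrite /walk_ends /= lw fe xw Guw -xw Gs; split=> // X e'.
  rewrite /walk_edges /= inE => /orP[/eqP->|Xs]; last exact: sP.
  by rewrite xw; apply: avoid.
exists (x, rcons s u); rewrite /walk_ends /= last_rcons rcons_path Gs lw symG Guw.
split=> //; first by rewrite xw fe setUC.
move=> X e'; rewrite walk_edges_rcons mem_rcons inE => /orP[/eqP->|Xs]; last exact: sP.
by rewrite lw setUC; apply: avoid.
Qed.

Lemma deg_upd f e S v : deg (upd f e S) v + (v \in f e) = deg f v + (v \in S).
Proof.
rewrite /deg (cardsD1 e) [in RHS](cardsD1 e) !inE /upd eqxx.
have -> : [set d : E | v \in (if d == e then S else f d)] :\ e = [set d | v \in f d] :\ e.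
  by apply/setP => x; rewrite !inE; case: eqP.
by lia.
Qed.

Lemma load_upd f e S : load (upd f e S) + (f e != set0) = load f + (S != set0).
Proof.
rewrite /load (cardsD1 e) [in RHS](cardsD1 e) !inE /upd eqxx.
have -> : [set d : E | (if d == e then S else f d) != set0] :\ e = [set d | f d != set0] :\ e.
  by apply/setP => x; rewrite !inE; case: eqP.
by lia.
Qed.

Lemma deg_gt0P f v : reflect (exists e, v \in f e) (0 < deg f v).
Proof.
rewrite card_gt0; apply: (iffP (set0Pn _)) => -[e]; last by exists e; rewrite inE.
by rewrite inE; exists e.
Qed.

Lemma mem_nonempty f e v : v \in f e -> f e != set0.
Proof. by move=> vfe; apply/set0Pn; exists v. Qed.

Lemma pairs_inP S f e u : pairs_in S f -> u \in f e ->
  exists v, [/\ u != v, f e = [set u; v], u \in S & v \in S].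
Proof.
move=> pf ufe; have [/eqP/cards2P[p [q [pq fe]]] /subsetP sub] := pf e (mem_nonempty ufe).
have [pS qS] : p \in S /\ q \in S by split; apply: sub; rewrite fe !inE eqxx ?orbT.
move: ufe; rewrite fe => /set2P[]->; first by exists q.
by exists p; rewrite eq_sym setUC.
Qed.

Lemma shift_pair u v w : u != v -> u != w ->
  shift u w [set u; v] = if w == v then set0 else [set w; v].
Proof.
move=> uv uw; rewrite /shift !inE [w == u]eq_sym (negbTE uw) /=.
case: eqVneq => // wv; apply/setP => x; rewrite !inE.
by case: (eqVneq x u) => [->|]; rewrite ?(negbTE uv) ?(negbTE uw).
Qed.

Lemma pairs_in_upd S f e u w : pairs_in S f -> u \in f e -> u != w -> w \in S ->
  pairs_in S (upd f e (shift u w (f e))).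
Proof.
move=> pf ufe uw wS x; rewrite /upd; case: (x =P e) => [_|_]; last exact: pf.
have [v [uv -> uS vS]] := pairs_inP pf ufe; rewrite shift_pair //.
case: (eqVneq w v) => [|wv _]; first by rewrite eqxx.
by rewrite cards2 wv subUset !sub1set wS vS.
Qed.

Definition bip A B : rel V :=
  fun x y => (x \in A) && (y \in B) || (x \in B) && (y \in A).

(* The complete bipartite graph on A and B, together with the edges that join *)
(* a vertex [a] outside of it to R.                                           *)
Definition hub A B a R : rel V := fun x y => bip A B x y || bip [set a] R x y.

Lemma bipC A B : bip A B =2 bip B A.
Proof. by move=> x y; rewrite /bip orbC. Qed.

Lemma bip_sym A B : symmetric (bip A B).
Proof. by move=> x y; rewrite /bip orbC andbC [X in _ || X]andbC. Qed.

Lemma hub_sym A B a R : symmetric (hub A B a R).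
Proof. by move=> x y; rewrite /hub !(bip_sym _ _ x y). Qed.

Lemma hub_mono A B a R R' : R \subset R' -> subrel (hub A B a R) (hub A B a R').
Proof.
move=> /subsetP sR x y; rewrite /hub /bip.
case/or3P => [->//|/andP[-> /sR->]|/andP[/sR-> ->]]; by rewrite ?orbT.
Qed.

Lemma sub_hub A B a R : subrel (bip A B) (hub A B a R).
Proof. by move=> x y; rewrite /hub => ->. Qed.

Lemma bip_setU1 A B a : hub A B a B =2 bip (a |: A) B.
Proof.
move=> x y; rewrite /hub /bip !inE.
by case: (x \in A); case: (x \in B); case: (y \in A); case: (y \in B);
  rewrite ?orbT ?andbF ?andbT ?orbF.
Qed.

Lemma hub_del A B a R b : a \notin A -> a \notin B -> a != b ->
  subrel (hub A B a (R :\ b)) (del (hub A B a R) a b).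
Proof.
move=> aA aB ab x y h; rewrite /del (hub_mono _ h) ?subD1set //=.
apply/negP => /eqP /pair_eq/(_ ab)[] [xE yE]; move: h; subst x y;
by rewrite /hub /bip !inE (negbTE aA) (negbTE aB) !eqxx [b == a]eq_sym (negbTE ab) /= ?andbF.
Qed.

End Routing.

(** * Moves through the star of a vertex *)

Section Moves.

Variables V E : finType.
Implicit Types (G : rel V) (f : E -> {set V}) (e : E) (u v w x y a b : V).
Implicit Types (A B R S : {set V}).

Definition shift_demand f e u w := upd f e (shift u w (f e)).

Section MoveEffect.

Variables (S : {set V}) (f : E -> {set V}) (e : E) (u w : V).
Hypotheses (pf : pairs_in S f) (ufe : u \in f e) (uw : u != w).

Lemma deg_move_other v : v != u -> v != w -> deg (shift_demand f e u w) v = deg f v.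
Proof.
move=> vu vw; have := deg_upd f e (shift u w (f e)) v; rewrite -/(shift_demand _ _ _ _).
have [z [uz -> _ _]] := pairs_inP pf ufe; rewrite shift_pair //.
by case: eqP => [<-|_]; rewrite !inE (negbTE vu) (negbTE vw) /=; slia.
Qed.

Lemma deg_move_src : (deg (shift_demand f e u w) u).+1 = deg f u.
Proof.
have := deg_upd f e (shift u w (f e)) u; rewrite -/(shift_demand _ _ _ _) ufe.
have [z [uz -> _ _]] := pairs_inP pf ufe; rewrite shift_pair //.
by case: eqP => _; rewrite !inE ?(negbTE uw) ?(negbTE uz) /=; slia.
Qed.

Lemma deg_move_dst :
  deg (shift_demand f e u w) w + (w \in f e) = deg f w + (w \notin f e).
Proof.
rewrite [LHS]deg_upd /shift; case: ifP => wf; first by rewrite inE.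
by rewrite !inE eqxx.
Qed.

Lemma load_move : load (shift_demand f e u w) + (w \in f e) = load f.
Proof.
have := load_upd f e (shift u w (f e)); rewrite -/(shift_demand _ _ _ _) (mem_nonempty ufe).
rewrite /shift; case: ifP => wf; first by rewrite eqxx; slia.
have -> : w |: f e :\ u != set0 by apply/set0Pn; exists w; rewrite !inE eqxx.
by slia.
Qed.

Lemma pairs_in_move : w \in S -> pairs_in S (shift_demand f e u w).
Proof. exact: pairs_in_upd. Qed.

End MoveEffect.

Lemma move_id f e u w d : d != e -> shift_demand f e u w d = f d.
Proof. by rewrite /shift_demand /upd => /negbTE->. Qed.

Lemma hub_send A B a R S f e b : a \notin A -> a \notin B -> b \in R -> a != b ->
  pairs_in S f -> a \in f e ->
  routable (hub A B a (R :\ b)) (shift_demand f e a b) -> routable (hub A B a R) f.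
Proof.
move=> aA aB bR ab pf afe rt; apply: (@route_move _ _ _ _ e a b) => //.
- exact: hub_sym.
- by rewrite /hub /bip !inE eqxx bR orbT.
- by case: (pf e (mem_nonempty afe)).
- by apply: routable_mono rt; apply: hub_del.
Qed.

(** Two routing steps, from [b1] to [a] and from [a] to [b2], amount to one shift from [b1] to
    [b2]. *)
Lemma hub_lift A B a R S f e b1 b2 : a \notin A -> a \notin B -> a \in S ->
  b1 \in R -> b2 \in R -> b1 != b2 -> a != b1 -> a != b2 ->
  pairs_in S f -> b1 \in f e -> a \notin f e ->
  routable (hub A B a (R :\ b1 :\ b2)) (shift_demand f e b1 b2) -> routable (hub A B a R) f.
Proof.
move=> aA aB aS b1R b2R b12 ab1 ab2 pf bfe afe rt.
have b1a : b1 != a by rewrite eq_sym.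
apply: (@route_move _ _ _ _ e b1 a) => //.
- exact: hub_sym.
- by rewrite hub_sym /hub /bip !inE eqxx b1R orbT.
- by case: (pf e (mem_nonempty bfe)).
have sD : subrel (hub A B a (R :\ b1)) (del (hub A B a R) b1 a).
  by move=> x y /(hub_del aA aB ab1); rewrite /del [[set b1; a]]setUC.
apply: (routable_mono sD); rewrite -/(shift_demand f e b1 a).
have afe' : a \in shift_demand f e b1 a e by rewrite /shift_demand /upd eqxx /shift (negbTE afe) !inE eqxx.
apply: (@hub_send A B a (R :\ b1) S _ e b2) => //.
- by rewrite !inE eq_sym b12.
- exact: pairs_in_move.
apply: routable_ext rt => d; rewrite /shift_demand /upd; case: (d =P e) => // _; rewrite eqxx.
have [z [b1z fe _ _]] := pairs_inP pf bfe; rewrite fe in afe *.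
rewrite !inE negb_or ab1 /= in afe.
by rewrite (shift_pair b1z b1a) (negbTE afe) !shift_pair.
Qed.

(** Each demand at [a] uses its own edge to [R], so a vertex of [R] gains at most one demand. The
    continuation has to route what remains without [a]. *)
Lemma send_all A B a R f : a \notin A -> a \notin B -> R \subset B ->
  pairs_in (a |: (A :|: B)) f -> deg f a <= #|R| ->
  (forall f', (forall d, a \notin f d -> f' d = f d) ->
     (forall v, deg f' v <= deg f v + (v \in R)) ->
     pairs_in (A :|: B) f' -> load f' <= load f -> routable (bip A B) f') ->
  routable (hub A B a R) f.
Proof.
move=> aA aB; have [n] := ubnP (deg f a); elim: n R f => // n IHn R f dn sRB pf dR cont.
have [/deg_gt0P[e ae]|d0] := boolP (0 < deg f a); last first.
  apply: (routable_mono (@sub_hub _ A B a R)); apply: cont => //.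
    by move=> v; apply: leq_addr.
  move=> e fe; have [-> sub] := pf e fe; split=> //; apply/subsetP => x xfe.
  have := subsetP sub _ xfe; rewrite in_setU1 => /orP[/eqP xa|//]; subst x.
  by case/negP: d0; apply/deg_gt0P; exists e.
have /card_gt0P[b bR] : 0 < #|R| by apply: leq_trans dR; apply/deg_gt0P; exists e.
have bB := subsetP sRB _ bR.
have ab : a != b by apply: contraNneq aB => ->.
have ds := deg_move_src pf ae ab.
apply: (hub_send aA aB bR ab pf ae); apply: IHn.
- by slia.
- by apply: subset_trans (subD1set _ _) sRB.
- by apply: pairs_in_move; rewrite // !inE bB !orbT.
- by move: dR; rewrite (cardsD1 b R) bR; slia.
move=> f' f'id f'deg pf' lf'; apply: cont => //.
- move=> d ad; have de : d != e by apply: contraNneq ad => ->.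
  by rewrite f'id move_id.
- move=> v; apply: leq_trans (f'deg v) _; rewrite !inE.
  have [->|va] := eqVneq v a; first by slia.
  have [->|vb] := eqVneq v b; last by rewrite (deg_move_other pf).
  by have := deg_move_dst f e a b; rewrite bR /=; case: (b \in f e) => /=; slia.
- by apply: leq_trans lf' _; have := load_move b ae; slia.
Qed.

Definition fits A B f :=
  [/\ pairs_in (A :|: B) f, {in A, forall x, deg f x <= #|B|}
    & {in B, forall b, deg f b <= #|A|}].

(** The invariant while the star of [a] is being used up: a vertex of [B] still counts [a] as a
    neighbour exactly when it lies in [R]. *)
Definition hub_fits A B a R f :=
  [/\ R \subset B, pairs_in (a |: (A :|: B)) f, {in A, forall x, deg f x <= #|B|}
    & {in B, forall b, deg f b <= #|A| + (b \in R)}].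

Definition heavy k R f := [set b in R | k <= deg f b].

Lemma common_edge f u v : load f < deg f u + deg f v ->
  exists e, u \in f e /\ v \in f e.
Proof.
move=> lf; have /card_gt0P[e] : 0 < #|[set e | u \in f e] :&: [set e | v \in f e]|.
  have := cardsUI [set e | u \in f e] [set e | v \in f e].
  have : #|[set e | u \in f e] :|: [set e | v \in f e]| <= load f.
    apply: subset_leq_card; apply/subsetP => e; rewrite !inE.
    by case/orP => /mem_nonempty.
  by move: lf; rewrite /deg; slia.
by rewrite !inE => /andP[]; exists e.
Qed.

Lemma sum_deg S f : \sum_(v in S) deg f v = \sum_e #|S :&: f e|.
Proof.
under eq_bigr => v _ do rewrite /deg -sum1_card big_mkcond /=.
rewrite exchange_big /=; apply: eq_bigr => e _.
rewrite -sum1_card [RHS]big_mkcond [LHS]big_mkcond /=.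
by apply: eq_bigr => v _; rewrite !inE; case: (v \in S); case: (v \in f e).
Qed.

Definition no_direct a R f := forall e, a \in f e -> [disjoint f e & R].

(** * Using up the star of the removed vertex *)

Section Hub.

Variables (A B : {set V}) (a : V).
Hypotheses (aA : a \notin A) (aB : a \notin B) (dAB : [disjoint A & B]).

Lemma hub_neq b : b \in B -> a != b.
Proof. by move=> bB; apply: contraNneq aB => ->. Qed.

(** Using the edge to [b2] cuts the capacity of [b2] to [#|A|]; if the demand is not served, it adds
    one to the degree of [b2], which must therefore be smaller. *)
Lemma hub_fits_lift R f e b1 b2 :
  hub_fits A B a R f -> b1 \in R -> b2 \in R -> b1 != b2 -> b1 \in f e ->
  b2 \in f e \/ deg f b2 < #|A| ->
  hub_fits A B a (R :\ b1 :\ b2) (shift_demand f e b1 b2).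
Proof.
move=> [sRB pf fA fB] b1R b2R b12 b1e b2e.
have [b1B b2B] := (subsetP sRB _ b1R, subsetP sRB _ b2R).
have ds := deg_move_src pf b1e b12; have dd := deg_move_dst f e b1 b2.
have fB1 := fB _ b1B; have fB2 := fB _ b2B; rewrite b1R b2R in fB1 fB2.
have d2 : deg (shift_demand f e b1 b2) b2 <= #|A|.
  by case: b2e dd => [->|]; [|case: (b2 \in f e)] => /=; slia.
split.
- by rewrite (subset_trans _ sRB) // !(subset_trans (subD1set _ _)).
- by apply: pairs_in_move => //; rewrite !inE b2B !orbT.
- move=> x xA; have xB : x \notin B by rewrite (disjointFr dAB).
  have [xb1 xb2] : x != b1 /\ x != b2 by split; apply: contraNneq xB => ->.
  by rewrite (deg_move_other pf) //; apply: fA.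
- move=> b bB; rewrite !inE; have [->|bb2] := eqVneq b b2; first by rewrite addn0.
  have [->|bb1] := eqVneq b b1; first by rewrite addn0 -ltnS ds -addn1.
  by rewrite /= (deg_move_other pf) //; apply: fB.
Qed.

Lemma hub_fits_send R f e b :
  hub_fits A B a R f -> b \in R -> a \in f e -> b \in f e ->
  hub_fits A B a (R :\ b) (shift_demand f e a b).
Proof.
move=> [sRB pf fA fB] bR ae be.
have bB := subsetP sRB _ bR; have ab := hub_neq bB.
have dd := deg_move_dst f e a b; have := fB _ bB; rewrite bR be /= in dd * => db.
split.
- by rewrite (subset_trans _ sRB) // subD1set.
- by apply: pairs_in_move => //; rewrite !inE bB !orbT.
- move=> x xA; have xB : x \notin B by rewrite (disjointFr dAB).
  have [xb xa] : x != b /\ x != a.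
    by split; [apply: contraNneq xB => -> | apply: contraNneq aA => <-].
  by rewrite (deg_move_other pf) //; apply: fA.
- move=> c cB; rewrite !inE; have [->|cb] := eqVneq c b; first by move: db dd; slia.
  have ca : c != a by rewrite eq_sym hub_neq.
  by rewrite /= (deg_move_other pf) //; apply: fB.
Qed.

Lemma heavy_lift S R f e k b1 b2 : pairs_in S f -> b1 \in f e -> b1 != b2 ->
  heavy k (R :\ b1 :\ b2) (shift_demand f e b1 b2) = heavy k R f :\ b1 :\ b2.
Proof.
move=> pf b1e b12; apply/setP => b; rewrite !inE.
case: (eqVneq b b2) => // bb2; case: (eqVneq b b1) => //= bb1.
by rewrite (deg_move_other pf).
Qed.

Lemma card_heavy_light k R f :
  #|heavy k R f| + #|[set b in R | deg f b < k]| = #|R|.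
Proof.
rewrite -(cardsID [set b | k <= deg f b] R); congr (_ + _); apply: eq_card => b.
  by rewrite !inE.
by rewrite !inE -ltnNge andbC.
Qed.

Variable M : nat.
Hypothesis IH : forall f, fits A B f -> load f <= M -> routable (bip A B) f.

(** Without tight vertices, the demands at [a] only have to be spread over the vertices of [R] of
    degree below [#|A|], and there are enough of those. *)
Lemma hub_light R f : hub_fits A B a R f -> {in R, forall b, deg f b <= #|A|} ->
  deg f a + #|heavy #|A| R f| <= #|R| -> load f <= M -> routable (hub A B a R) f.
Proof.
move=> [sRB pf fA fB] fR dR lM.
set L := [set b in R | deg f b < #|A|].
have sLR : L \subset R by apply/subsetP => b; rewrite inE => /andP[].
apply: (routable_mono (hub_mono (R := L) sLR)).
apply: send_all => //; first exact: subset_trans sRB.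
  by have := card_heavy_light #|A| R f; rewrite -/L; slia.
move=> f' _ f'deg pf' lf'; apply: IH; last exact: leq_trans lM.
split=> // [x xA|b bB].
  have xL : x \notin L.
    have xB : x \notin B by rewrite (disjointFr dAB).
    by apply: contra xB => /(subsetP sLR)/(subsetP sRB).
  by have := f'deg x; rewrite (negbTE xL) addn0 => /leq_trans; apply; apply: fA.
apply: leq_trans (f'deg b) _; rewrite inE.
have [bR|bR] := boolP (b \in R); last by have := fB b bB; rewrite (negbTE bR) /= !addn0.
by have := fR b bR; case: ltnP => /=; slia.
Qed.

(* Tight vertices of R, those of degree #|A|+1, are pairwise joined by        *)
(* demands since their degrees add up to more than the load: they are paired  *)
(* off and a demand of each pair is routed through [a].  If one is left over, *)
(* one of its demands is passed through [a] on to a vertex of small degree.   *)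
Lemma hub_balanced R f : hub_fits A B a R f -> no_direct a R f ->
  deg f a + #|heavy #|A| R f| + odd #|heavy #|A|.+1 R f| <= #|R| ->
  load f <= M -> load f < #|A|.+1.*2 -> routable (hub A B a R) f.
Proof.
have [n] := ubnP #|R|; elim: n R f => // n IHn R f Rn hf nd dR lM lA.
have [sRB pf fA fB] := hf.
have fR : {in R, forall b, deg f b <= #|A|.+1}.
  by move=> b bR; have := fB b (subsetP sRB _ bR); rewrite bR addn1.
have inHT b : b \in heavy #|A|.+1 R f -> b \in heavy #|A| R f.
  by rewrite !inE => /andP[->]; slia.
set T := heavy #|A|.+1 R f in dR inHT.
have [T0|/set0Pn[b1 b1T]] := eqVneq T set0.
  apply: hub_light => //; last by slia.
  move=> b bR; rewrite -ltnS ltnNge; apply/negP => db.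
  suff : b \in T by rewrite T0 inE.
  by rewrite inE bR.
have := b1T; rewrite inE => /andP[b1R d1].
have b1B := subsetP sRB _ b1R; have ab1 := hub_neq b1B.
have b1H := inHT _ b1T.
have cT := cardsD1 b1 T; rewrite b1T in cT.
have cH := cardsD1 b1 (heavy #|A| R f); rewrite b1H in cH.
have cR := cardsD1 b1 R; rewrite b1R in cR.
have aS : a \in a |: (A :|: B) by rewrite !inE eqxx.
(* With a single tight vertex the parity term is 1, which guarantees a vertex of degree below [#|A|]
   to take over a demand. *)
have [T1|/set0Pn[b2]] := eqVneq (T :\ b1) set0.
  rewrite T1 cards0 in cT; rewrite cT /= in dR.
  have := card_heavy_light #|A| R f => cL.
  have /card_gt0P[b2] : 0 < #|[set b in R | deg f b < #|A|]| by slia.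
  rewrite inE => /andP[b2R d2].
  have b12 : b1 != b2 by apply: contraTneq d2 => <-; slia.
  have b2B := subsetP sRB _ b2R; have ab2 := hub_neq b2B.
  have [e b1e] : exists e, b1 \in f e by apply/deg_gt0P; slia.
  have ae : a \notin f e.
    by apply/negP => /nd/pred0P/(_ b1) /=; rewrite b1e b1R.
  have cR2 := cardsD1 b2 (R :\ b1); rewrite !inE eq_sym b12 b2R /= in cR2.
  apply: (hub_lift aA aB aS b1R b2R b12 ab1 ab2 pf b1e ae).
  apply: hub_light.
  - by apply: hub_fits_lift => //; right.
  - move=> b; rewrite !inE => /and3P[bb2 bb1 bR]; rewrite (deg_move_other pf) //.
    rewrite -ltnS ltnNge; apply/negP => db.
    suff : b \in T :\ b1 by rewrite T1 inE.
    by rewrite !inE bb1 bR.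
  - rewrite (deg_move_other pf) // (heavy_lift _ _ pf) //.
    have := subset_leq_card (subD1set (heavy #|A| R f :\ b1) b2).
    by slia.
  - by have := load_move b2 b1e; slia.
rewrite 2!inE => /andP[b21 b2T].
have b12 : b1 != b2 by rewrite eq_sym.
have := b2T; rewrite inE => /andP[b2R d2].
have b2B := subsetP sRB _ b2R; have ab2 := hub_neq b2B.
have b2H := inHT _ b2T.
have [e [b1e b2e]] : exists e, b1 \in f e /\ b2 \in f e by apply: common_edge; slia.
have ae : a \notin f e.
  by apply/negP => /nd/pred0P/(_ b1) /=; rewrite b1e b1R.
have cT2 := cardsD1 b2 (T :\ b1); rewrite in_setD1 b21 b2T /= in cT2.
have cH2 := cardsD1 b2 (heavy #|A| R f :\ b1); rewrite in_setD1 b21 b2H /= in cH2.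
have cR2 := cardsD1 b2 (R :\ b1); rewrite !inE b21 b2R /= in cR2.
have lm := load_move b2 b1e; rewrite b2e in lm.
apply: (hub_lift aA aB aS b1R b2R b12 ab1 ab2 pf b1e ae).
apply: IHn.
- by slia.
- by apply: hub_fits_lift => //; left.
- move=> d; have [->|de] := eqVneq d e.
    by rewrite /shift_demand /upd eqxx /shift b2e inE.
  rewrite move_id // => /nd; apply: disjointWr.
  by apply: subset_trans (subD1set _ _) (subD1set _ _).
(* The free edges and the heavy vertices both decrease by two, and the parity of the tight ones is
   unchanged. *)
- rewrite !(heavy_lift _ _ pf) // -/T (deg_move_other pf) //.
  by move: dR; rewrite cT cT2 /= negbK; slia.
- by slia.
- by slia.
Qed.

End Hub.

End Moves.

(** * Counting demands and removing one vertex *)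

Section Reduction.

Variables V E : finType.
Implicit Types (G : rel V) (f : E -> {set V}) (e : E) (u v w x y a b : V).
Implicit Types (A B R S : {set V}).

Lemma sum_deg_touch S f c : (forall e, #|S :&: f e| <= c) ->
  \sum_(v in S) deg f v <= c * #|[set e | ~~ [disjoint f e & S]]|.
Proof.
move=> Sc; rewrite sum_deg -sum1_card big_distrr /= [leqRHS]big_mkcond /=.
apply: leq_sum => e _; rewrite inE muln1; case: ifP => //= /negbFE.
by rewrite disjoint_sym -setI_eq0 => /eqP->; rewrite cards0.
Qed.

Lemma pairs_in_card S f e : pairs_in S f -> #|f e| <= 2.
Proof.
by move=> pf; have [->|/pf[->]//] := eqVneq (f e) set0; rewrite cards0.
Qed.

Lemma meet_card2 S' S f : pairs_in S f -> forall e, #|S' :&: f e| <= 2.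
Proof.
move=> pf e; apply: leq_trans (pairs_in_card e pf).
by apply: subset_leq_card; apply: subsetIr.
Qed.

Lemma deg_touch S f v : v \in S -> deg f v <= #|[set e | ~~ [disjoint f e & S]]|.
Proof.
move=> vS; apply: subset_leq_card; apply/subsetP => e; rewrite !inE => ve.
by apply/pred0Pn; exists v; rewrite /= ve vS.
Qed.

Lemma deg_touch_load a S f : (forall e, a \in f e -> [disjoint f e & S]) ->
  deg f a + #|[set e | ~~ [disjoint f e & S]]| <= load f.
Proof.
move=> nd; rewrite -cardsUI.
have -> : [set e | a \in f e] :&: [set e | ~~ [disjoint f e & S]] = set0.
  by apply/setP => e; rewrite !inE; case: (boolP (a \in f e)) => // /nd ->.
rewrite cards0 addn0; apply: subset_leq_card; apply/subsetP => e.
rewrite !inE => /orP[/mem_nonempty //|]; apply: contraNneq => ->.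
by rewrite -setI_eq0 set0I.
Qed.

Lemma heavyS k R f : heavy k.+1 R f \subset heavy k R f.
Proof. by apply/subsetP => b; rewrite !inE => /andP[->] /ltnW. Qed.

Lemma heavy_sum k R f : k * #|heavy k R f| + #|heavy k.+1 R f| <=
  \sum_(b in heavy k R f) deg f b.
Proof.
have -> : k * #|heavy k R f| + #|heavy k.+1 R f| =
    \sum_(b in heavy k R f) (k + (b \in heavy k.+1 R f)).
  rewrite big_split /= sum_nat_const mulnC; congr (_ + _).
  rewrite -sum1_card big_mkcond [RHS]big_mkcond; apply: eq_bigr => b _.
  case: ifP => [/(subsetP (heavyS _ _ _))->//|_]; by case: ifP.
by apply: leq_sum => b; rewrite !inE => /andP[-> kb] /=; case: ltnP => /=; slia.
Qed.

Section Hub.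

Variables (A B : {set V}) (a : V).
Hypotheses (aA : a \notin A) (aB : a \notin B) (dAB : [disjoint A & B]).

Lemma hub_disjoint : [disjoint a |: A & B].
Proof.
rewrite disjoint_subset; apply/subsetP => x /setU1P[->|xA]; rewrite inE //.
by rewrite (disjointFr dAB).
Qed.

Lemma no_direct_heavy k R f : no_direct a R f ->
  forall e, a \in f e -> [disjoint f e & heavy k R f].
Proof.
move=> nd e /nd; apply: disjointWr; apply/subsetP => b; by rewrite inE => /andP[].
Qed.

(** Let H and T be the two heavy sets and Y the number of demands meeting H. Then deg a + Y is at
    most the load, and |A| |H| + |T| <= 2 Y, since a demand has two ends. If |H| = 1, the degree of
    the single heavy vertex bounds Y directly. *)
Lemma hub_count R f : hub_fits A B a R f -> no_direct a R f -> 2 <= #|A| ->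
  deg f a <= #|R| -> load f + 2 <= #|A| + #|R| ->
  deg f a + #|heavy #|A| R f| + odd #|heavy #|A|.+1 R f| <= #|R|.
Proof.
move=> [sRB pf fA fB] nd A2 dR lR.
have hY := leq_trans (heavy_sum #|A| R f) (sum_deg_touch (meet_card2 _ pf)).
have hd := deg_touch_load (no_direct_heavy #|A| nd).
set Y := #|[set e | _]| in hY hd.
have HY b : b \in heavy #|A| R f -> deg f b <= Y by apply: deg_touch.
have TH := subset_leq_card (heavyS #|A| R f).
have [H0|/card_gt0P[b bH]] := posnP #|heavy #|A| R f|.
  by move: TH; rewrite H0 leqn0 => /eqP->; rewrite !addn0.
have [H1|H1] := leqP #|heavy #|A| R f| 1.
  have HT : #|A| + #|heavy #|A|.+1 R f| <= Y.
    have [->|/card_gt0P[c cT]] := posnP #|heavy #|A|.+1 R f|.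
      by apply: leq_trans (HY b bH); move: bH; rewrite inE addn0 => /andP[].
    have := HY c (subsetP (heavyS _ _ _) _ cT); move: cT; rewrite inE => /andP[_].
    by slia.
  by case: (odd _) (erefl (odd #|heavy #|A|.+1 R f|)) => /=; slia.
have : 2 * #|heavy #|A| R f| + 2 * #|A| <= #|A| * #|heavy #|A| R f| + 4.
  (* This is (p - 2)(q - 2) >= 0. *)
  have nm p q : 1 < p -> 1 < q -> 2 * q + 2 * p <= p * q + 4 by clear; nia.
  exact: nm.
have := odd_double_half #|heavy #|A|.+1 R f|.
by slia.
Qed.

Variable M : nat.
Hypothesis IH : forall f, fits A B f -> load f <= M -> routable (bip A B) f.
Hypotheses (A2 : 2 <= #|A|) (BA : #|B| <= #|A|.+1).

(** Serving a demand between [a] and [R] lowers [deg f a], [#|R|] and the load by one each, so the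
    hypotheses persist until [hub_count] applies. *)
Lemma hub_reduce R f : hub_fits A B a R f -> deg f a <= #|R| ->
  load f + 2 <= #|A| + #|R| -> load f <= M -> routable (hub A B a R) f.
Proof.
have [n] := ubnP #|R|; elim: n R f => // n IHn R f Rn hf dR lR lM.
have [sRB pf fA fB] := hf.
have RB := subset_leq_card sRB.
have [/existsP[e /andP[ae /pred0Pn[b /andP[/= be bR]]]]|] :=
  boolP [exists e, (a \in f e) && ~~ [disjoint f e & R]].
  have bB := subsetP sRB _ bR; have ab := hub_neq aB bB.
  have cR := cardsD1 b R; rewrite bR in cR.
  have lm := load_move b ae; rewrite be in lm.
  have ds := deg_move_src pf ae ab.
  apply: (hub_send aA aB bR ab pf ae); apply: IHn; try slia.
  exact: hub_fits_send.
rewrite negb_exists => /forallP nd0.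
have nd : no_direct a R f by move=> e ae; have := nd0 e; rewrite ae /= negbK.
apply: (hub_balanced aA aB dAB IH) => //; last by slia.
exact: hub_count.
Qed.

Lemma fits_hub f : fits (a |: A) B f -> hub_fits A B a B f /\ deg f a <= #|B|.
Proof.
move=> [pf fA fB]; split; last by apply: fA; rewrite setU11.
split=> // [|x xA|b bB]; first by rewrite setUA.
  by apply: fA; rewrite inE xA orbT.
by apply: leq_trans (fB b bB) _; rewrite bB cardsU1 aA addnC.
Qed.

Lemma routable_hub f : routable (hub A B a B) f -> routable (bip (a |: A) B) f.
Proof. by apply: routable_mono => x y; rewrite bip_setU1. Qed.

(** The case of slack: the load already satisfies the bound [M] for the smaller graph. *)
Lemma remove_any f : fits (a |: A) B f -> load f + 2 <= #|A| + #|B| ->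
  load f <= M -> routable (bip (a |: A) B) f.
Proof. by move=> /fits_hub[hf da] lf lM; apply/routable_hub/hub_reduce. Qed.

Lemma remove_direct f e b : fits (a |: A) B f -> b \in B -> a \in f e -> b \in f e ->
  load f + 2 <= #|A| + #|B| -> load f <= M.+1 -> routable (bip (a |: A) B) f.
Proof.
move=> /fits_hub[hf da] bB ae be lf lM; apply: routable_hub.
have [_ pf _ _] := hf; have ab := hub_neq aB bB.
have cR := cardsD1 b B; rewrite bB in cR.
have lm := load_move b ae; rewrite be in lm.
have ds := deg_move_src pf ae ab.
apply: (hub_send aA aB bB ab pf ae); apply: hub_reduce; try slia.
exact: hub_fits_send.
Qed.

Lemma hub_complete R S f e y z : a \in S -> R \subset B -> pairs_in S f ->
  y \in R -> z \in R -> y != z -> y \in f e -> z \in f e ->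
  routable (hub A B a (R :\ y :\ z)) (upd f e set0) -> routable (hub A B a R) f.
Proof.
move=> aS sRB pf yR zR yz ye ze rt.
have [ay az] := (hub_neq aB (subsetP sRB _ yR), hub_neq aB (subsetP sRB _ zR)).
have ae : a \notin f e.
  have [t [yt fe _ _]] := pairs_inP pf ye; move: ze; rewrite fe !inE.
  by rewrite [z == y]eq_sym (negbTE yz) (negbTE ay) /= => /eqP<-.
apply: (hub_lift aA aB aS yR zR yz ay az pf ye ae).
by rewrite /shift_demand /shift ze.
Qed.

(* A demand inside B is routed through [a].  Its ends are chosen among the    *)
(* vertices of large degree as far as possible; when there are none, [a] has  *)
(* enough free edges because its degree is minimal in its side.               *)
Lemma remove_inside f e0 : fits (a |: A) B f -> #|A| <= #|B| ->
  (forall e, (f e \subset a |: A) || (f e \subset B)) ->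
  f e0 != set0 -> f e0 \subset B ->
  {in A, forall x, deg f a <= deg f x} ->
  load f + 2 <= #|A| + #|B| -> load f <= M.+1 -> routable (bip (a |: A) B) f.
Proof.
move=> ff AB split e00 e0B amin lf lM.
have [hf da] := fits_hub ff; have [_ pf fA fB] := hf.
have nd : no_direct a B f.
  move=> e ae; case/orP: (split e) => [sub|/subsetP/(_ a ae)]; last by rewrite (negbTE aB).
  exact: disjointWl sub hub_disjoint.
have inB e b : b \in B -> b \in f e -> f e \subset B.
  move=> bB be; case/orP: (split e) => // /subsetP/(_ b be); rewrite !inE.
  by rewrite (disjointFl dAB) // orbF => /eqP ba; case/negP: aB; rewrite -ba.
have cnt := hub_count hf nd A2 da lf.
set H := heavy #|A| B f in cnt; set T := heavy #|A|.+1 B f in cnt.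
have HB : H \subset B by apply/subsetP => b; rewrite inE => /andP[].
have TH : T \subset H := heavyS _ _ _.
(* Serving {y, z} through [a] costs two free edges, whence the 2; the inequality is then the one
   that [hub_balanced] needs. *)
suff [e [y [z [yB zB yz [ye ze] ok]]]] : exists e y z, [/\ y \in B, z \in B, y != z,
    y \in f e /\ z \in f e & deg f a + #|H :\ y :\ z| + odd #|T :\ y :\ z| + 2 <= #|B|].
  have cB := cardsD1 y B; rewrite yB in cB.
  have cB2 := cardsD1 z (B :\ y); rewrite in_setD1 eq_sym yz zB /= in cB2.
  apply: routable_hub.
  have ae : a \notin f e by apply/negP => /nd/pred0P/(_ y) /=; rewrite ye yB.
  have lm := load_move z ye; rewrite ze in lm.
  have [ay az] := (hub_neq aB yB, hub_neq aB zB).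
  apply: (hub_lift aA aB _ yB zB yz ay az pf ye ae); first by rewrite setU11.
  apply: (hub_balanced aA aB dAB IH); try slia.
  - by apply: hub_fits_lift => //; left.
  - move=> d; have [->|de] := eqVneq d e.
      by rewrite /shift_demand /upd eqxx /shift ze inE.
    rewrite move_id // => /nd; apply: disjointWr.
    by apply: subset_trans (subD1set _ _) (subD1set _ _).
  - by rewrite !(heavy_lift _ _ pf) // -/T -/H (deg_move_other pf) //; slia.
have pair e y : y \in B -> y \in f e -> exists z, [/\ z \in B, y != z & z \in f e].
  move=> yB ye; have [z [yz fe _ _]] := pairs_inP pf ye.
  have ze : z \in f e by rewrite fe set22.
  by exists z; split=> //; apply: (subsetP (inB e y yB ye)).
have le2 (S : {set V}) y z : #|S :\ y :\ z| <= #|S :\ y| := subset_leq_card (subD1set _ _).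
have [H0|/set0Pn[h hH]] := eqVneq H set0.
  have T0 : T = set0 by apply/eqP; rewrite -subset0 -H0.
  have [y ye0] := set0Pn _ e00; have yB := subsetP e0B _ ye0.
  have [z [zB yz ze0]] := pair _ _ yB ye0.
  exists e0, y, z; split=> //; rewrite H0 T0 !set0D cards0 /= !addn0.
  have sA : \sum_(x in a |: A) deg f x <= 2 * #|[set e | ~~ [disjoint f e & a |: A]]|.
    exact: sum_deg_touch (meet_card2 _ pf).
  have : #|[set e | ~~ [disjoint f e & a |: A]]| < load f.
    rewrite /load [in leqRHS](cardsD1 e0) inE e00 ltnS.
    apply: subset_leq_card; apply/subsetP => e; rewrite !inE => te.
    apply/andP; split; last by apply: contraNneq te => ->; rewrite -setI_eq0 set0I.
    apply: contraNneq te => ->; apply: disjointWl e0B _.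
    by rewrite disjoint_sym hub_disjoint.
  have : deg f a * #|A|.+1 <= \sum_(x in a |: A) deg f x.
    have <- : #|a |: A| = #|A|.+1 by rewrite cardsU1 aA.
    rewrite mulnC -sum_nat_const; apply: leq_sum => x; rewrite in_setU1.
    by case/orP => [/eqP->|/amin].
  move: sA; set s := \sum_(x in a |: A) deg f x; set Y := #|[set e | _]|.
  move=> sY Yl sd.
  (* Minimality of [deg f a] bounds [#|A|.+1] times it by twice the number of demands inside its
     side, which is less than the load because of [e0]. *)
  have key p q d : 1 < p -> d * p.+1 + 6 <= 2 * (p + q) -> p = q \/ p.+1 = q -> d + 2 <= q.
    by clear => p2 h [pq|pq]; subst q; nia.
  apply: (key #|A|) => //; first by slia.
  by have : #|A| = #|B| \/ #|A|.+1 = #|B| by slia.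
have cH := cardsD1 h H; rewrite hH in cH.
have hB := subsetP HB _ hH.
have [T0|/set0Pn[t tT]] := eqVneq T set0; last first.
  have tH := subsetP TH _ tT; have tB := subsetP HB _ tH.
  have dt : #|A| < deg f t by move: tT; rewrite inE => /andP[].
  have cHt := cardsD1 t H; rewrite tH in cHt.
  have cT := cardsD1 t T; rewrite tT in cT.
  have [T1|/set0Pn[t']] := eqVneq (T :\ t) set0.
    have [e te] : exists e, t \in f e by apply/deg_gt0P; slia.
    have [z [zB tz ze]] := pair _ _ tB te.
    exists e, t, z; split=> //; rewrite T1 set0D cards0 /= addn0.
    rewrite T1 cards0 in cT; rewrite cT /= in cnt.
    by have := le2 H t z; slia.
  rewrite in_setD1 => /andP[t't t'T].
  have t'H := subsetP TH _ t'T; have t'B := subsetP HB _ t'H.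
  have dt' : #|A| < deg f t' by move: t'T; rewrite inE => /andP[].
  have [e [te t'e]] : exists e, t \in f e /\ t' \in f e by apply: common_edge; slia.
  have cH2 := cardsD1 t' (H :\ t); rewrite in_setD1 t't t'H /= in cH2.
  have cT2 := cardsD1 t' (T :\ t); rewrite in_setD1 t't t'T /= in cT2.
  exists e, t, t'; split=> //; first by rewrite eq_sym.
  by move: cnt; rewrite cT cT2 /= negbK; slia.
rewrite T0 cards0 /= addn0 in cnt.
have [/existsP[e He]|Hfree] := boolP [exists e, 1 < #|H :&: f e|].
  have /card_gt0P[y] : 0 < #|H :&: f e| by apply: leq_trans He.
  rewrite inE => /andP[yH ye].
  move: He; rewrite (cardsD1 y) inE yH ye ltnS => /card_gt0P[z].
  rewrite in_setD1 in_setI => /and3P[zy zH ze].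
  have [yB zB] := (subsetP HB _ yH, subsetP HB _ zH).
  exists e, y, z; split=> //; first by rewrite eq_sym.
  have cHy := cardsD1 y H; rewrite yH in cHy.
  have cHz := cardsD1 z (H :\ y); rewrite in_setD1 zy zH /= in cHz.
  by rewrite T0 !set0D cards0 /=; slia.
have dh : #|A| <= deg f h by move: hH; rewrite inE => /andP[].
have [e he] : exists e, h \in f e by apply/deg_gt0P; slia.
have [z [zB hz ze]] := pair _ _ hB he.
exists e, h, z; split=> //; rewrite T0 !set0D cards0 /= addn0.
have H1 d : #|H :&: f d| <= 1.
  by rewrite leqNgt; apply: contra Hfree => Hd; apply/existsP; exists d.
have hY := leq_trans (heavy_sum #|A| B f) (sum_deg_touch H1).
have hd := deg_touch_load (no_direct_heavy #|A| nd).
rewrite -/T -/H T0 cards0 addn0 mul1n in hY; rewrite -/H in hd.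
have : #|H| + #|A| <= #|A| * #|H| + 1.
  have : 0 < #|H| by rewrite cH.
  (* This is (p - 1)(q - 1) >= 0. It suffices since here every demand meets H at most once, which
     doubles the yield of the count. *)
  have nm p q : 1 < p -> 0 < q -> q + p <= p * q + 1 by clear; nia.
  exact: nm.
by have := le2 H h z; slia.
Qed.

End Hub.
End Reduction.

(** * Base case and exceptional configurations *)

Section Induction.

Variables V E : finType.
Implicit Types (G : rel V) (f : E -> {set V}) (e : E) (u v w x y a b : V).
Implicit Types (A B R S : {set V}).

Lemma routable_load_le1 A B f a b : a \in A -> b \in B ->
  pairs_in (A :|: B) f -> load f <= 1 -> routable (bip A B) f.
Proof.
move=> aA bB pf lf.
have uf e e' : f e != set0 -> f e' != set0 -> e = e'.
  by move=> fe fe'; apply: (card_le1_eqP lf); rewrite inE.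
have [/existsP[e fe]|nf] := boolP [exists e, f e != set0]; last first.
  by exists (fun=> (a, [::])); split=> [e|e e'] fe; case/existsP: nf; exists e.
suff [W [GW eW]] : exists W : V * seq V, path (bip A B) W.1 W.2 /\ walk_ends W = f e.
  exists (fun=> W); split=> [d fd|d d' fd fd']; first by rewrite (uf d e).
  by rewrite (uf d d') // eqxx.
have [u ue] := set0Pn _ fe.
have [v [uv -> /setUP[uA|uB] /setUP[vA|vB]]] := pairs_inP pf ue.
- by exists (u, [:: b; v]); rewrite /walk_ends /= /bip uA vA bB /= orbT.
- by exists (u, [:: v]); rewrite /walk_ends /= /bip uA vB.
- by exists (u, [:: v]); rewrite /walk_ends /= /bip uB vA orbT.
- by exists (u, [:: a; v]); rewrite /walk_ends /= /bip uB vB aA /= orbT.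
Qed.

Lemma routable_bipC A B f : routable (bip A B) f -> routable (bip B A) f.
Proof. by apply: routable_mono => x y; rewrite bipC. Qed.

Lemma fitsC A B f : fits A B f -> fits B A f.
Proof. by case=> pf fA fB; split=> //; rewrite setUC. Qed.

Section Simple.

Variable f : E -> {set V}.
Variable S : {set V}.
Hypothesis pf : pairs_in S f.
Hypothesis simple_f : forall e e', f e != set0 -> f e = f e' -> e = e'.

Lemma simple_common u v : u != v ->
  #|[set e | u \in f e] :&: [set e | v \in f e]| <= 1.
Proof.
move=> uv; apply/card_le1_eqP => e e'; rewrite !inE => /andP[ue ve] /andP[ue' ve'].
have fE d : u \in f d -> v \in f d -> f d = [set u; v].
  move=> ud; have [w [uw -> _ _]] := pairs_inP pf ud.
  by rewrite !inE [v == u]eq_sym (negbTE uv) /= => /eqP->.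
by apply: simple_f; [exact: (mem_nonempty ue') | rewrite (fE e) // (fE e')].
Qed.

Lemma simple_avoid1 u v : u != v -> 2 <= deg f u -> exists e, u \in f e /\ v \notin f e.
Proof.
move=> uv du; have c1 := simple_common uv.
have := cardsID [set e | v \in f e] [set e | u \in f e]; rewrite -/(deg f u) => cD.
have /card_gt0P[e] : 0 < #|[set e | u \in f e] :\: [set e | v \in f e]| by slia.
by rewrite !inE => /andP[ve ue]; exists e.
Qed.

Lemma simple_avoid2 u v w : u != v -> u != w -> 3 <= deg f u ->
  exists e, [/\ u \in f e, v \notin f e & w \notin f e].
Proof.
move=> uv uw du; have c1 := simple_common uv; have c2 := simple_common uw.
set U := [set e | u \in f e] in c1 c2; set X := [set e | v \in f e] in c1.
set Y := [set e | w \in f e] in c2.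
have := cardsID X U; rewrite -/(deg f u) => cX.
have := cardsID Y (U :\: X) => cY.
have cUY : #|(U :\: X) :&: Y| <= #|U :&: Y| by apply/subset_leq_card/setSI/subsetDl.
have dU : deg f u = #|U| by [].
have /card_gt0P[e] : 0 < #|(U :\: X) :\: Y| by slia.
by rewrite !inE => /and3P[we ve ue]; exists e.
Qed.

Lemma avoid_vertex x : deg f x < load f -> exists e, f e != set0 /\ x \notin f e.
Proof.
move=> lx; have /card_gt0P[e] : 0 < #|[set e | f e != set0] :\: [set e | x \in f e]|.
  have := cardsID [set e | x \in f e] [set e | f e != set0]; rewrite -/(load f).
  have : #|[set e | f e != set0] :&: [set e | x \in f e]| <= deg f x.
    by apply/subset_leq_card/subsetIr.
  by slia.
by rewrite !inE => /andP[xe fe]; exists e.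
Qed.

(** At most three vertices have degree q. One demand takes one of them, a disjoint one takes the
    others; absence of parallels leaves enough choice to avoid given vertices. *)
Lemma disjoint_demands q : 3 <= q -> (forall x, deg f x <= q) ->
  load f + 2 = 2 * q ->
  exists e1 e2, [/\ f e1 != set0, f e2 != set0, [disjoint f e1 & f e2]
    & forall x, deg f x = q -> x \in f e1 :|: f e2].
Proof.
move=> q3 dq lq; set T := [set x | deg f x == q].
have inT x : deg f x = q -> x \in T by rewrite inE => ->.
have Td x : x \in T -> deg f x = q by rewrite inE => /eqP.
have T3 : #|T| <= 3.
  have hT := sum_deg_touch (meet_card2 T pf).
  have : q * #|T| <= \sum_(v in T) deg f v.
    by rewrite mulnC -sum_nat_const; apply: leq_sum => v /Td->.
  have : #|[set e | ~~ [disjoint f e & T]]| <= load f.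
    apply: subset_leq_card; apply/subsetP => e; rewrite !inE.
    by apply: contraNneq => ->; rewrite -setI_eq0 set0I.
  set s := \sum_(v in T) _ in hT *; set Y := #|_| in hT * => YL qs.
  have : q * #|T| < 4 * q by slia.
  by rewrite mulnC ltn_mul2r => /andP[].
(* First [e2] is chosen to avoid [x] and cover the rest of [T]; then one of the three demands at [x]
   misses both ends of [e2]. *)
have big x : 3 <= deg f x -> (T == set0) || (x \in T) -> exists e1 e2,
    [/\ f e1 != set0, f e2 != set0, [disjoint f e1 & f e2] &
      forall y, deg f y = q -> y \in f e1 :|: f e2].
  move=> dx xT; suff [e2 [fe2 xe2 Te2]] : exists e2, [/\ f e2 != set0, x \notin f e2 &
      T :\ x \subset f e2].
    have [z ze2] := set0Pn _ fe2; have [w [zw fzw _ _]] := pairs_inP pf ze2.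
    move: xe2; rewrite fzw !inE negb_or => /andP[xz xw].
    have [e1 [xe1 ze1 we1]] := simple_avoid2 xz xw dx.
    exists e1, e2; split=> //; first exact: mem_nonempty xe1.
      rewrite disjoint_sym disjoint_subset; apply/subsetP => y.
      by rewrite fzw => /set2P[]->; rewrite inE.
    move=> y /inT yT; rewrite inE; have [->|yx] := eqVneq y x; first by rewrite xe1.
    by rewrite (subsetP Te2) ?orbT // in_setD1 yx.
  have [T0|/set0Pn[z]] := eqVneq (T :\ x) set0.
    have [e [fe xe]] : exists e, f e != set0 /\ x \notin f e.
      by apply: avoid_vertex; have := dq x; slia.
    by exists e; rewrite T0 sub0set.
  rewrite in_setD1 => /andP[zx zT]; have dz := Td _ zT.
  have [T0|/set0Pn[w]] := eqVneq (T :\ x :\ z) set0.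
    have [e [ze xe]] : exists e, z \in f e /\ x \notin f e by apply: simple_avoid1 => //; slia.
    exists e; split=> //; first exact: mem_nonempty ze.
    apply/subsetP => y yT; have [->//|yz] := eqVneq y z.
    by have : y \in T :\ x :\ z by [rewrite in_setD1 yz]; rewrite T0 inE.
  rewrite !in_setD1 => /and3P[wz wx wT]; have dw := Td _ wT.
  have [e [ze we]] : exists e, z \in f e /\ w \in f e by apply: common_edge; slia.
  have fe : f e = [set z; w].
    have [t [zt fE _ _]] := pairs_inP pf ze; move: we; rewrite fE !inE.
    by rewrite (negbTE wz) /= => /eqP->.
  exists e; split; first exact: mem_nonempty ze.
    by rewrite fe !inE negb_or ![x == _]eq_sym zx wx.
  have {}xT : x \in T.
    by case/orP: xT => // /eqP T0; rewrite T0 inE in zT.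
  have T0 : #|T :\ x :\ z :\ w| = 0.
    have c1 := cardsD1 x T; rewrite xT in c1.
    have c2 := cardsD1 z (T :\ x); rewrite in_setD1 zx zT /= in c2.
    have c3 := cardsD1 w (T :\ x :\ z); rewrite !in_setD1 wz wx wT /= in c3.
    by slia.
  apply/subsetP => y yT; rewrite fe !inE; apply/orP.
  have [->|yz] := eqVneq y z; [by left | right].
  apply: contraT => yw; have : y \in T :\ x :\ z :\ w by rewrite !in_setD1 yw yz -in_setD1.
  by rewrite (cards0_eq T0) inE.
have [T0|/set0Pn[x xT]] := eqVneq T set0; last first.
  by apply: (big x); rewrite ?(Td _ xT) // xT orbT.
have [/existsP[x dx]|d3] := boolP [exists x, 3 <= deg f x].
  by apply: (big x) => //; rewrite T0 eqxx.
have d2 x : deg f x <= 2.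
  by rewrite leqNgt; apply: contra d3 => dx; apply/existsP; exists x.
have /card_gt0P[e1] : 0 < load f by slia.
rewrite inE => fe1; have [x xe1] := set0Pn _ fe1.
have [y [xy fxy _ _]] := pairs_inP pf xe1.
have ye1 : y \in f e1 by rewrite fxy set22.
(* All degrees are at most 2, so at most three demands meet [e1], itself included, while the load is
   at least 4. *)
have [e2 [fe2 xe2 ye2]] : exists e2, [/\ f e2 != set0, x \notin f e2 & y \notin f e2].
  set X := [set e | x \in f e]; set Y := [set e | y \in f e].
  have cXY := cardsUI X Y.
  have : 0 < #|X :&: Y| by apply/card_gt0P; exists e1; rewrite !inE xe1 ye1.
  have dX : #|X| <= 2 := d2 x; have dY : #|Y| <= 2 := d2 y => pXY.
  have := cardsID (X :|: Y) [set e | f e != set0]; rewrite -/(load f).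
  have : #|[set e | f e != set0] :&: (X :|: Y)| <= #|X :|: Y|.
    by apply/subset_leq_card/subsetIr.
  move=> h1 h2.
  have /card_gt0P[e] : 0 < #|[set e | f e != set0] :\: (X :|: Y)| by slia.
  by rewrite !inE negb_or -andbA => /and3P[? ? ?]; exists e.
exists e1, e2; split=> //.
  rewrite disjoint_subset; apply/subsetP => v.
  by rewrite fxy => /set2P[]->; rewrite inE.
by move=> v dv; have := d2 v; rewrite dv; slia.
Qed.

End Simple.

Definition fit_routable A B := forall f,
  fits A B f -> load f + 3 <= #|A| + #|B| -> routable (bip A B) f.

(** * All demands inside the larger side, without slack *)

Section Stuck.

Variables (A B : {set V}) (f : E -> {set V}).
Hypotheses (dAB : [disjoint A & B]) (ff : fits A B f) (fA : forall e, f e \subset A).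
Hypotheses (cAB : #|A| = #|B|.+1) (lf : load f + 3 = #|A| + #|B|).

Lemma stuck_pairs : pairs_in A f.
Proof. by case: ff => pf _ _ e fe; split=> //; case: (pf e fe). Qed.

Lemma stuck_deg0 b : b \notin A -> deg f b = 0.
Proof.
move=> bA; apply/eqP; rewrite -leqn0 leqNgt; apply/negP => /deg_gt0P[e be].
by case/negP: bA; apply: (subsetP (fA e)).
Qed.

Lemma stuck_deg x : deg f x <= #|B|.
Proof.
have [xA|/stuck_deg0->//] := boolP (x \in A).
by case: ff => _ dA _; apply: dA.
Qed.

(** A vertex [b] serves two disjoint demands that cover the vertices of full degree, so all degrees
    drop below [#|B|]. The sides then differ by two, and removing any vertex of [A] makes them
    differ by one again. *)
Lemma stuck_simple : 3 <= #|B| ->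
  (forall e e', f e != set0 -> f e = f e' -> e = e') ->
  (forall A' B', A' \proper A -> B' \proper B -> #|A'| = #|B'|.+1 -> fit_routable A' B') ->
  routable (bip A B) f.
Proof.
move=> B3 simple_f IH.
have [e1 [e2 [fe1 fe2 dis cov]]] : exists e1 e2, [/\ f e1 != set0, f e2 != set0,
    [disjoint f e1 & f e2] & forall x, deg f x = #|B| -> x \in f e1 :|: f e2].
  by apply: (disjoint_demands stuck_pairs simple_f B3 stuck_deg); slia.
have /card_gt0P[b bB] : 0 < #|B| by slia.
have bA : b \notin A by rewrite (disjointFl dAB).
have bB' : b \notin B :\ b by rewrite !inE eqxx.
have cB := cardsD1 b B; rewrite bB in cB.
apply: routable_bipC; rewrite -(setD1K bB); apply: routable_hub.
have [x xe1] := set0Pn _ fe1; have [y [xy fxy xA yA]] := pairs_inP stuck_pairs xe1.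
have [z ze2] := set0Pn _ fe2; have [w [zw fzw zA wA]] := pairs_inP stuck_pairs ze2.
have ye1 : y \in f e1 by rewrite fxy set22.
have we2 : w \in f e2 by rewrite fzw set22.
have nin v : v \in f e2 -> v \notin f e1 by move=> ve2; rewrite (disjointFl dis).
have [zx zy] : z != x /\ z != y.
  by have := nin _ ze2; rewrite fxy !inE negb_or => /andP.
have [wx wy] : w != x /\ w != y.
  by have := nin _ we2; rewrite fxy !inE negb_or => /andP.
have e12 : e2 != e1 by apply/eqP => E12; have := nin _ ze2; rewrite -E12 ze2.
have pS : pairs_in (b |: (B :\ b :|: A)) f.
  move=> e /stuck_pairs[-> sub]; split=> //; apply: subset_trans sub _.
  by rewrite setUA subsetUr.
have bS : b \in b |: (B :\ b :|: A) by rewrite setU11.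
apply: (hub_complete bB' bA bS (subxx A) pS xA yA xy xe1 ye1).
set f1 := upd f e1 set0.
have f1e2 : f1 e2 = f e2 by rewrite /f1 /upd (negbTE e12).
have pS1 : pairs_in (b |: (B :\ b :|: A)) f1.
  by move=> e; rewrite /f1 /upd; case: (e =P e1) => [_|_]; [rewrite eqxx | apply: pS].
apply: (hub_complete bB' bA bS _ pS1 (y := z) (z := w) (e := e2)) => //.
- by apply: subset_trans (subD1set _ _) (subD1set _ _).
- by rewrite !in_setD1 zx zy.
- by rewrite !in_setD1 wx wy.
- by rewrite f1e2.
- by rewrite f1e2.
apply: (routable_mono (@sub_hub _ _ _ _ _)); apply: routable_bipC.
set f2 := upd f1 e2 set0.
have dE v : deg f2 v + (v \in f e1 :|: f e2) = deg f v.
  have := deg_upd f e1 set0 v; have := deg_upd f1 e2 set0 v; rewrite -/f1 -/f2 f1e2 !inE.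
  have [/nin/negbTE->|ve2] := boolP (v \in f e2); rewrite ?orbF ?orbT /=; slia.
have lE : load f2 + 2 = load f.
  have := load_upd f e1 set0; have := load_upd f1 e2 set0.
  by rewrite -/f1 -/f2 f1e2 fe1 fe2 eqxx; slia.
have cA := cardsD1 x A; rewrite xA in cA.
have xB : x \notin B :\ b.
  by rewrite in_setD1 negb_and (disjointFr dAB) ?orbT.
have dAB1 : [disjoint A :\ x & B :\ b].
  by apply: disjointWl (subD1set _ _) (disjointWr (subD1set _ _) dAB).
rewrite -(setD1K xA).
apply: (@remove_any _ _ (A :\ x) (B :\ b) x _ xB dAB1 (2 * #|B| - 4)); try slia.
- by rewrite !inE eqxx.
- move=> g fg lg; apply: IH => //; try slia.
  + by rewrite properD1.
  + by rewrite properD1.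
rewrite setD1K //; split.
- move=> e; rewrite /f2 /upd; case: (e =P e2) => [_|_]; first by rewrite eqxx.
  rewrite /f1 /upd; case: (e =P e1) => [_|_]; first by rewrite eqxx.
  by move=> /stuck_pairs[-> sub]; split=> //; apply: subset_trans sub (subsetUl _ _).
- move=> v vA; have := dE v; have := stuck_deg v; have [|vn] := boolP (v \in f e1 :|: f e2).
    by slia.
  have : deg f v != #|B| by apply: contraNneq vn => /cov.
  by slia.
- move=> c; rewrite in_setD1 => /andP[_ cB'].
  by have := dE c; rewrite stuck_deg0 ?(disjointFl dAB) //; slia.
Qed.

(* Both ends of the parallel demands are removed.  No vertex of B is the end  *)
(* of a demand at first, hence all of them stay far below their capacity.     *)
Lemma stuck_parallel e1 e2 : 3 <= #|B| -> e1 != e2 -> f e1 != set0 -> f e1 = f e2 ->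
  (forall A', A' \proper A -> #|A'|.+1 = #|B| -> fit_routable A' B) ->
  routable (bip A B) f.
Proof.
move=> B3 e12 fe1 fE IH.
have [u ue1] := set0Pn _ fe1; have [v [uv fuv uA vA]] := pairs_inP stuck_pairs ue1.
have ue2 : u \in f e2 by rewrite -fE.
have uB : u \notin B by rewrite (disjointFr dAB).
have vB : v \notin B by rewrite (disjointFr dAB).
have vu : v != u by rewrite eq_sym.
set A1 := A :\ u; set A2 := A1 :\ v.
have vA1 : v \in A1 by rewrite in_setD1 vu.
have uA1 : u \notin A1 by rewrite !inE eqxx.
have vA2 : v \notin A2 by rewrite !inE eqxx.
have cA := cardsD1 u A; rewrite uA -/A1 in cA.
have cA1 := cardsD1 v A1; rewrite vA1 -/A2 in cA1.
have sA1 : A1 \subset A := subD1set _ _.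
have sA2 : A2 \subset A := subset_trans (subD1set _ _) sA1.
have /card_gt0P[b1 b1B] : 0 < #|B| by slia.
have cB := cardsD1 b1 B; rewrite b1B in cB.
have /card_gt0P[b2] : 0 < #|B :\ b1| by slia.
rewrite in_setD1 => /andP[b21 b2B].
have b12 : b1 != b2 by rewrite eq_sym.
have cB2 := cardsD1 b2 (B :\ b1); rewrite in_setD1 b21 b2B /= in cB2.
have [ub1 ub2] : u != b1 /\ u != b2 by split; apply: contraNneq uB => ->.
have [vb1 vb2] : v != b1 /\ v != b2 by split; apply: contraNneq vB => ->.
have b1A : b1 \notin A by rewrite (disjointFl dAB).
have b2A : b2 \notin A by rewrite (disjointFl dAB).
have pS : pairs_in (u |: (A1 :|: B)) f.
  move=> e /stuck_pairs[-> sub]; split=> //; apply: subset_trans sub _.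
  by rewrite setUA setD1K // subsetUl.
rewrite -(setD1K uA); apply: routable_hub.
apply: (hub_send uA1 uB b1B ub1 pS ue1).
set f1 := shift_demand f e1 u b1.
have pS1 : pairs_in (u |: (A1 :|: B)) f1 by apply: pairs_in_move; rewrite // !inE b1B !orbT.
have f1e2 : f1 e2 = f e2 by rewrite /f1 move_id // eq_sym.
have ue2' : u \in f1 e2 by rewrite f1e2.
have b2B1 : b2 \in B :\ b1 by rewrite in_setD1 b21.
apply: (hub_send uA1 uB b2B1 ub2 pS1 ue2').
set f2 := shift_demand f1 e2 u b2.
have pS2 : pairs_in (u |: (A1 :|: B)) f2 by apply: pairs_in_move; rewrite // !inE b2B !orbT.
have f2e1 : f2 e1 = [set b1; v].
  rewrite /f2 move_id // /f1 /shift_demand /upd eqxx fuv shift_pair //.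
  by rewrite eq_sym (negbTE vb1).
have f2e2 : f2 e2 = [set b2; v].
  rewrite /f2 /shift_demand /upd eqxx f1e2 -fE fuv shift_pair //.
  by rewrite eq_sym (negbTE vb2).
have d2u : deg f2 u + 2 = deg f u.
  by have := deg_move_src pS1 ue2' ub2; have := deg_move_src pS ue1 ub1; rewrite -/f1 -/f2; slia.
have d2o x : x != u -> x != b1 -> x != b2 -> deg f2 x = deg f x.
  by move=> xu x1 x2; rewrite (deg_move_other pS1) // (deg_move_other pS).
have d2b1 : deg f2 b1 = 1.
  rewrite (deg_move_other pS1) // 1?eq_sym //; have := deg_move_dst f e1 u b1.
  by rewrite -/f1 stuck_deg0 // fuv !inE ![b1 == _]eq_sym (negbTE ub1) (negbTE vb1) /=; slia.
have d2b2 : deg f2 b2 = 1.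
  have := deg_move_dst f1 e2 u b2; rewrite (deg_move_other pS) // 1?eq_sym // -/f1 -/f2.
  by rewrite stuck_deg0 // f1e2 -fE fuv !inE ![b2 == _]eq_sym (negbTE ub2) (negbTE vb2) /=; slia.
have l2 : load f2 <= load f.
  by have := load_move b2 ue2'; have := load_move b1 ue1; rewrite -/f1 -/f2; slia.
(* The other demands at [u] avoid [b1] and [b2], so that every vertex of [B] ends up with at most
   one demand. *)
apply: send_all => //.
- by apply: subset_trans (subD1set _ _) (subD1set _ _).
- by have := stuck_deg u; slia.
move=> f3 f3E d3 p3 l3.
have {}f3e1 : f3 e1 = [set b1; v].
  by rewrite f3E f2e1 // !inE negb_or ub1 uv.
have {}f3e2 : f3 e2 = [set b2; v].
  by rewrite f3E f2e2 // !inE negb_or ub2 uv.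
have d3B b : b \in B -> deg f3 b <= 1.
  move=> bB; have := d3 b; rewrite !in_setD1 bB andbT.
  have [->|bb2] := eqVneq b b2; first by rewrite d2b2 addn0.
  have [->|bb1] := eqVneq b b1; first by rewrite d2b1 addn0.
  rewrite d2o ?stuck_deg0 ?(disjointFl dAB) //.
  by apply: contraNneq uB => <-.
have d3A x : x \in A1 -> deg f3 x <= #|B|.
  move=> xA1; have xA := subsetP sA1 _ xA1.
  have xB : x \notin B by rewrite (disjointFr dAB).
  have [xu xb1 xb2] : [/\ x != u, x != b1 & x != b2].
    by split; [move: xA1; rewrite in_setD1 => /andP[] | |];
      try (apply: contraNneq xB => ->).
  have := d3 x; rewrite d2o // !in_setD1 (negbTE xB) !andbF addn0 => /leq_trans; apply.
  exact: stuck_deg.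
have dA2B : [disjoint A2 & B] := disjointWl sA2 dAB.
have hf3 : hub_fits A2 B v B f3.
  split=> // [|x|b bB].
  - by rewrite setUA setD1K.
  - by rewrite in_setD1 => /andP[_]; apply: d3A.
  - by apply: leq_trans (d3B b bB) _; slia.
have ve1 : v \in f3 e1 by rewrite f3e1 set22.
have b1e1 : b1 \in f3 e1 by rewrite f3e1 set21.
have p3' : pairs_in (v |: (A2 :|: B)) f3 by case: hf3.
rewrite -(setD1K vA1) -/A2; apply: routable_hub.
apply: (hub_send vA2 vB b1B vb1 p3' ve1).
have hf4 := hub_fits_send vA2 vB dA2B hf3 b1B ve1 b1e1.
have l4 := load_move b1 ve1; rewrite b1e1 in l4.
have d4v := deg_move_src p3' ve1 vb1.
have d4o x : x != v -> x != b1 -> deg (shift_demand f3 e1 v b1) x = deg f3 x.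
  exact: deg_move_other p3' ve1 vb1 x.
have f4e2 : shift_demand f3 e1 v b1 e2 = [set b2; v] by rewrite move_id // eq_sym.
set f4 := shift_demand f3 e1 v b1 in hf4 l4 d4v d4o f4e2 *.
have ve2 : v \in f4 e2 by rewrite f4e2 set22.
have b2e2 : b2 \in f4 e2 by rewrite f4e2 set21.
have p4 : pairs_in (v |: (A2 :|: B)) f4 by case: hf4.
apply: (hub_send vA2 vB b2B1 vb2 p4 ve2).
have hf5 := hub_fits_send vA2 vB dA2B hf4 b2B1 ve2 b2e2.
have l5 := load_move b2 ve2; rewrite b2e2 in l5.
have d5v := deg_move_src p4 ve2 vb2.
have d5o x : x != v -> x != b2 -> deg (shift_demand f4 e2 v b2) x = deg f4 x.
  exact: deg_move_other p4 ve2 vb2 x.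
have d5B b : b \in B :\ b1 :\ b2 -> deg (shift_demand f4 e2 v b2) b <= 1.
  rewrite !in_setD1 => /and3P[bb2 bb1 bB].
  have bv : b != v by apply: contraTneq bB => ->.
  by rewrite d5o // d4o // d3B.
set f5 := shift_demand f4 e2 v b2 in hf5 l5 d5v d5o d5B *.
apply: (hub_light vA2 vB dA2B (M := 2 * #|B| - 4)) => //; try slia.
- move=> g fg lg; apply: IH => //; try slia.
  by apply: sub_proper_trans (subD1set _ _) _; rewrite properD1.
- by move=> b /d5B; slia.
have -> : heavy #|A2| (B :\ b1 :\ b2) f5 = set0.
  apply/setP => b; rewrite [RHS]inE [LHS]inE.
  by apply/negP => /andP[/d5B]; slia.
have := d3A v vA1; rewrite cards0; slia.
Qed.

End Stuck.

End Induction.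

(** * The induction on the number of vertices *)

Section Main.

Variables V E : finType.
Implicit Types (f : E -> {set V}) (e : E) (a b x : V) (A B : {set V}).

Lemma remove_vertex A B f :
  [disjoint A & B] -> #|B| <= #|A| -> #|A| <= #|B|.+1 -> 3 <= #|A| ->
  (forall A', A' \proper A -> #|A'|.+1 = #|A| -> fit_routable E A' B) ->
  fits A B f -> load f + 3 <= #|A| + #|B| ->
  [\/ load f + 4 <= #|A| + #|B|,
      exists e a b, [/\ a \in A, b \in B, a \in f e & b \in f e]
    | (forall e, (f e \subset A) || (f e \subset B)) /\
      exists2 e, f e != set0 & f e \subset B] ->
  routable (bip A B) f.
Proof.
move=> dAB BA AB A3 IH ff lf cases.
have del1 a : a \in A -> [/\ a \notin A :\ a, a \notin B, [disjoint A :\ a & B],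
    #|A| = #|A :\ a|.+1 & forall g : E -> {set V}, fits (A :\ a) B g ->
      load g <= #|A :\ a| + #|B| - 3 -> routable (bip (A :\ a) B) g].
  move=> aA; have cA := cardsD1 a A; rewrite aA in cA; split=> //.
  - by rewrite !inE eqxx.
  - by rewrite (disjointFr dAB).
  - exact: disjointWl (subD1set _ _) dAB.
  - by move=> g fg lg; apply: IH; rewrite ?properD1 //; slia.
case: cases => [sl|[e [a [b [aA bB ae be]]]]|[split [e fe eB]]].
- have /card_gt0P[a aA] : 0 < #|A| by slia.
  have [aA' aB dA cA IHa] := del1 a aA.
  by rewrite -(setD1K aA); apply: (remove_any aA' aB dA IHa); rewrite ?setD1K //; slia.
- have [aA' aB dA cA IHa] := del1 a aA.
  rewrite -(setD1K aA); apply: (remove_direct aA' aB dA IHa _ _ _ bB ae be);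
    rewrite ?setD1K //; slia.
have /card_gt0P[a0 a0A] : 0 < #|A| by slia.
case: (arg_minnP (deg f) a0A) => a aA amin.
have [aA' aB dA cA IHa] := del1 a aA.
rewrite -(setD1K aA); apply: (remove_inside aA' aB dA IHa _ _ _ _ _ fe eB);
  rewrite ?setD1K //; try slia.
by move=> x; rewrite in_setD1 => /andP[_ xA]; apply: amin.
Qed.

(** This settles [#|B| = 2]: one demand passes through [b], and the other is routed in the graph
    without [b]. *)
Lemma stuck_small A B f : [disjoint A & B] -> fits A B f ->
  (forall e, f e \subset A) -> 1 < #|B| -> load f = 2 -> routable (bip A B) f.
Proof.
move=> dAB ff fA B1 l2; have pA := stuck_pairs ff fA.
have /card_gt0P[e] : 0 < load f by slia.
rewrite inE => fe; have [x xe] := set0Pn _ fe; have [y [xy fxy xA yA]] := pairs_inP pA xe.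
have ye : y \in f e by rewrite fxy set22.
have /card_gt0P[b bB] : 0 < #|B| by slia.
have cB := cardsD1 b B; rewrite bB in cB.
have /card_gt0P[b' b'B] : 0 < #|B :\ b| by slia.
have bA : b \notin A by rewrite (disjointFl dAB).
have bB' : b \notin B :\ b by rewrite !inE eqxx.
have pS : pairs_in (b |: (B :\ b :|: A)) f.
  move=> d /pA[-> sub]; split=> //; apply: subset_trans sub _.
  by rewrite setUA subsetUr.
apply: routable_bipC; rewrite -(setD1K bB); apply: routable_hub.
apply: (hub_complete bB' bA _ (subxx A) pS xA yA xy xe ye); first exact: setU11.
apply: (routable_mono (@sub_hub _ _ _ _ _)).
apply: (routable_load_le1 b'B xA).
  move=> d; rewrite /upd; case: (d =P e) => [_|_]; first by rewrite eqxx.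
  by move=> /pA[-> sub]; split=> //; apply: subset_trans sub (subsetUr _ _).
by have := load_upd f e set0; rewrite fe eqxx; slia.
Qed.

Theorem fit_routable_balanced A B : [disjoint A & B] ->
  #|A| <= #|B|.+1 -> #|B| <= #|A|.+1 -> fit_routable E A B.
Proof.
have [n] := ubnP (#|A| + #|B|); elim: n A B => // n IHn A B.
wlog BA : A B / #|B| <= #|A|.
  move=> IH sz dAB AB BA f ff lf; case: (leqP #|B| #|A|) => [le|/ltnW le].
    exact: IH.
  by apply/routable_bipC/IH; rewrite ?(addnC #|B|) 1?disjoint_sym //; apply: fitsC.
move=> sz dAB AB _ f ff lf.
have IHp A' B' : A' \subset A -> B' \subset B -> #|A'| + #|B'| < #|A| + #|B| ->
    #|A'| <= #|B'|.+1 -> #|B'| <= #|A'|.+1 -> fit_routable E A' B'.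
  move=> sA sB lt; apply: IHn; first by slia.
  exact: disjointWl sA (disjointWr sB dAB).
have [l1|l2] := leqP (load f) 1.
  have /card_gt0P[a aA] : 0 < #|A| by slia.
  have /card_gt0P[b bB] : 0 < #|B| by slia.
  by apply: (routable_load_le1 aA bB) => //; case: ff.
have A3 : 2 < #|A| by slia.
have IHA A' : A' \proper A -> #|A'|.+1 = #|A| -> fit_routable E A' B.
  by move=> /proper_sub sA cA; apply: IHp => //; slia.
have [/existsP[e /andP[/pred0Pn[a /andP[/= ae aA]] /pred0Pn[b /andP[/= be bB]]]]|nAB] :=
    boolP [exists e, ~~ [disjoint f e & A] && ~~ [disjoint f e & B]].
  by apply: remove_vertex => //; apply: Or32; exists e, a, b.
have [pf _ _] := ff.
have split e : (f e \subset A) || (f e \subset B).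
  have [->|fe] := eqVneq (f e) set0; first by rewrite sub0set.
  have [_ /subsetP sub] := pf e fe.
  have : [disjoint f e & A] || [disjoint f e & B].
    by apply: contraNT nAB; rewrite negb_or => h; apply/existsP; exists e.
  case/orP => dis; apply/orP; [right|left]; apply/subsetP => x xe.
    by have := sub x xe; rewrite inE (disjointFr dis xe).
  by have := sub x xe; rewrite inE (disjointFr dis xe) orbF.
have [/existsP[e /andP[fe eB]]|nB] := boolP [exists e, (f e != set0) && (f e \subset B)].
  by apply: remove_vertex => //; apply: Or33; split=> //; exists e.
have fA e : f e \subset A.
  have [->|fe] := eqVneq (f e) set0; first by rewrite sub0set.
  case/orP: (split e) => // eB; case/existsP: nB; exists e; by rewrite fe.
(* For equal sides the roles are exchanged: a vertex of [B] is removed and serves a demand inside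
   [A]. *)
have [cAB|cAB] : #|A| = #|B| \/ #|A| = #|B|.+1 by slia.
  have /card_gt0P[e] : 0 < load f by slia.
  rewrite inE => fe; apply/routable_bipC/remove_vertex; rewrite 1?disjoint_sym //; try slia.
  - move=> B' /proper_sub sB cB g fg lg; apply: routable_bipC.
    by apply: (IHp A B') => //; try slia; apply: fitsC.
  - exact: fitsC.
  - apply: Or33; split; last by exists e.
    by move=> d; rewrite orbC.
have [l4|l3] := leqP (load f + 4) (#|A| + #|B|).
  by apply: remove_vertex => //; apply: Or31.
have {l3}lf' : load f + 3 = #|A| + #|B| by slia.
have [B3|B2] := leqP 3 #|B|; last by apply: stuck_small => //; slia.
have [/existsP[e1 /existsP[e2 /and3P[e12 fe1 /eqP fE]]]|simple] :=
    boolP [exists e1, exists e2, [&& e1 != e2, f e1 != set0 & f e1 == f e2]].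
  apply: (stuck_parallel dAB ff fA cAB lf' B3 e12 fe1 fE) => A' /proper_sub sA cA.
  by apply: IHp => //; slia.
apply: stuck_simple => // [e1 e2 fe1 fE|A' B' /proper_sub sA pB cA].
  apply/eqP; apply: contraNT simple => e12; apply/existsP; exists e1; apply/existsP.
  by exists e2; rewrite e12 fe1 fE eqxx.
have := proper_card pB; move: (proper_sub pB) => sB lt.
by apply: IHp => //; slia.
Qed.

End Main.

(** * From walks to paths, and the square case *)

Lemma realizable_of_routable (V : finType) (G : sgraph V) (D : multigraph V) :
  routable G (@ends _ D) -> realizable G D.
Proof.
case=> P [Pp Pd].
have ne (e : edge D) : ends e != set0 by rewrite -card_gt0 edge_ends.
have short (W : V * seq V) : path G W.1 W.2 -> exists W', [/\ is_path G W',
    walk_ends W' = walk_ends W & {subset walk_edges W' <= walk_edges W}].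
  case: W => x p /= Gp.
  (* Membership in the original walk is built into the relation, so that shortening cannot introduce
     new edges. *)
  pose H := [rel u v | G u v && ([set u; v] \in walk_edges (x, p))].
  have Hp : path H x p.
    suff sub (s : seq {set V}) : path G x p -> {subset walk_edges (x, p) <= s} ->
        path [rel u v | G u v && ([set u; v] \in s)] x p by apply: sub.
    elim: p x {Gp H} => //= y p IHp x /andP[Gxy Gp] sub; rewrite Gxy sub ?mem_head //=.
    by apply: IHp => // X Xp; apply: sub; rewrite /walk_edges /= in_cons Xp orbT.
  rewrite /walk_ends /=; case/shortenP: Hp => p' Hp' up' _.
  exists (x, p'); rewrite /is_path /=; split=> //.
    by rewrite [_ && uniq _]up' andbT; apply: sub_path Hp' => u v /andP[].
  by move=> X /(walk_edgesP Hp')[y [z [/andP[_ yz] ->]]].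
have [Q QP] : exists Q : edge D -> V * seq V, forall e, [/\ is_path G (Q e),
    walk_ends (Q e) = ends e & {subset walk_edges (Q e) <= walk_edges (P e)}].
  apply: (@fin_all_exists _ _ (fun e (W : V * seq V) => [/\ is_path G W,
    walk_ends W = ends e & {subset walk_edges W <= walk_edges (P e)}])) => e.
  have [Ge We] := Pp e (ne e); have [W [pW eW sW]] := short _ Ge.
  by exists W; rewrite eW.
exists Q; split=> [e|e e' ee']; first by have [? ? _] := QP e.
have [[_ _ s1] [_ _ s2]] := (QP e, QP e').
apply/pred0P => X /=; apply/negP => /andP[/s1 X1 /s2 X2].
by have /pred0P/(_ X) := Pd e e' (ne e) (ne e') ee'; rewrite /= X1 X2.
Qed.

Theorem theorem3 (n : nat) (D : multigraph ('I_n + 'I_n)%type) :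
  2 <= n -> #|edge D| <= 2 * n - 3 -> max_degree D <= n ->
  realizable (Knn n) D.
Proof.
move=> n2 eD dD.
set A : {set 'I_n + 'I_n} := inl @: [set: 'I_n].
set B : {set 'I_n + 'I_n} := inr @: [set: 'I_n].
have inA i : (inl i \in A) * (inr i \in A = false).
  split; first by rewrite imset_f.
  by apply/negP => /imsetP[].
have inB i : (inr i \in B) * (inl i \in B = false).
  split; first by rewrite imset_f.
  by apply/negP => /imsetP[].
have cA : #|A| = n by rewrite card_imset ?cardsT ?card_ord // => i j [].
have cB : #|B| = n by rewrite card_imset ?cardsT ?card_ord // => i j [].
have dAB : [disjoint A & B].
  by rewrite disjoint_subset; apply/subsetP => -[i|i]; rewrite !inE ?inA ?inB.
have dn v : deg (@ends _ D) v <= n.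
  by apply: leq_trans dD; apply: (leq_bigmax (F := degree D)).
apply: realizable_of_routable.
apply: (@routable_mono _ _ (bip A B)).
  by move=> [i|i] [j|j]; rewrite /bip ?inA ?inB.
apply: fit_routable_balanced => //; rewrite ?cA ?cB //.
  split=> [e _|x _|b _]; rewrite ?cA ?cB //; split; first exact: edge_ends.
  by apply/subsetP => -[i|i] _; rewrite !inE ?inA ?inB ?orbT.
(* Since [2 <= n], the subtraction in [2 * n - 3] is exact, and the load plus 3 is at most
   [n + n]. *)
have : load (@ends _ D) <= #|edge D| by apply: max_card.
by slia.
Qed.
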